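(* Let $G$ be a topological group and let $(\mu_i)_{i\in I}$ be a net of Borel probability measures on $G$ UEB-converging to invariance over $G$. If $d$ is a continuous pseudo-metric on a $G$-flow $X$, then there exists $x_0\in X$ such that $$\sup_{g\in G} d(x_0,gx_0)\ \le\ \sup_{\alpha>0}\ \liminf_{i\to I}\ \sup_{x\in X}\mathrm{ObsDiam}(G,d_{G,x},\mu_i;-\alpha),$$ where for $x\in X$ the pseudo-metric $d_{G,x}$ on $G$ is defined by $d_{G,x}(g,h):=d(gx,hx)$ for $g,h\in G$.
   Context: Topological groups are Hausdorff. A $G$-flow is a non-empty compact Hausdorff space together with a continuous action of $G$ on it. The right uniformity of $G$ is generated by the entourages $\{(x,y)\in G\times G: yx^{-1}\in U\}$, $U$ a neighborhood of the neutral element. $\mathrm{RUCB}(G)$ is the set of bounded real-valued functions on $G$ that are uniformly continuous with respect to the right uniformity; $\mathrm{RUEB}(G)$ is the set of all subsets $H\subseteq\mathrm{RUCB}(G)$ that are bounded in supremum norm and uniformly equicontinuous with respect to the right uniformity. For $g\in G$ let $\lambda_g\colon G\to G,\ x\mapsto gx$. A net $(\mu_i)_{i\in I}$ of Borel probability measures on $G$ UEB-converges to invariance over $G$ if for every $g\in G$ and every $H\in\mathrm{RUEB}(G)$, $$\sup_{f\in H}\left|\int f\circ\lambda_g\,d\mu_i-\int f\,d\mu_i\right|\longrightarrow0\qquad(i\to I).$$ For $\alpha>0$ and a Borel probability measure $\nu$ on $\mathbb{R}$, let $\mathrm{PartDiam}(\nu,1-\alpha):=\inf\{\operatorname{diam}(B):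 B\subseteq\mathbb{R}\text{ Borel},\ \nu(B)\ge1-\alpha\}$, with Euclidean diameter. For a Borel probability measure $\mu$ on a topological space $Y$ and a continuous pseudo-metric $\rho$ on $Y$, the $\alpha$-observable diameter is $$\mathrm{ObsDiam}(Y,\rho,\mu;-\alpha):=\sup\{\mathrm{PartDiam}(f_*(\mu),1-\alpha): f\colon Y\to\mathbb{R}\ \text{1-Lipschitz w.r.t. }\rho\},$$ where $f_*(\mu)(B)=\mu(f^{-1}(B))$. *)

(* Defs.v *)
From HB Require Import structures.
From mathcomp Require Import all_boot all_order all_algebra.
From mathcomp Require Import all_classical all_reals all_analysis.

Set Implicit Arguments.
Unset Strict Implicit.
Unset Printing Implicit Defensive.

Import Order.TTheory GRing.Theory Num.Theory.
Import numFieldNormedType.Exports.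

Local Open Scope classical_set_scope.
Local Open Scope ring_scope.

(* The library only has additive (commutative) topological groups. The point   *)
(* inherited from PointedTopological is irrelevant, but g_sigma_algebraType    *)
(* expects a pointed type. Being Hausdorff is a separate hypothesis.           *)
HB.mixin Record PointedTopological_isTopologicalGroup G
    & PointedTopological G & Group G := {
  mulg_continuous : continuous (fun p : G * G => (p.1 * p.2)%g) ;
  invg_continuous : continuous (fun x : G => (x^-1)%g)
}.

#[short(type="topologicalGroupType")]
HB.structure Definition TopologicalGroup :=
  {G of PointedTopological G & Group G & PointedTopological_isTopologicalGroup G}.

Definition borelType (Y : ptopologicalType) := g_sigma_algebraType (@open Y).

Record is_flow (G : topologicalGroupType) (X : topologicalType)
    (act : G -> X -> X) : Prop := IsFlow {
  flow_nonempty : [set: X] !=set0 ;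
  flow_compact : compact [set: X] ;
  flow_hausdorff : hausdorff_space X ;
  flow_act1 : forall x, act 1%g x = x ;
  flow_actM : forall g h x, act (g * h)%g x = act g (act h x) ;
  flow_continuous : continuous (fun p : G * X => act p.1 p.2)
}.

Record is_pseudometric (R : realType) (Y : Type) (rho : Y -> Y -> R) : Prop :=
    IsPseudometric {
  pseudometric_ge0 : forall x y, 0 <= rho x y ;
  pseudometric_refl : forall x, rho x x = 0 ;
  pseudometric_sym : forall x y, rho x y = rho y x ;
  pseudometric_triangle : forall x y z, rho x z <= rho x y + rho y z
}.

Definition is_continuous_pseudometric (R : realType) (Y : topologicalType)
    (rho : Y -> Y -> R) : Prop :=
  is_pseudometric rho /\ continuous (fun p : Y * Y => rho p.1 p.2).

Record is_directed (I : Type) (le : I -> I -> Prop) : Prop := IsDirected {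
  directed_inhabited : inhabited I ;
  directed_refl : forall i, le i i ;
  directed_trans : forall i j k, le i j -> le j k -> le i k ;
  directed_ub : forall i j, exists k, le i k /\ le j k
}.

Definition tails (I : Type) (le : I -> I -> Prop) : set_system I :=
  filter_from [set: I] (fun i => [set j | le i j]).

Definition net_liminf (R : realType) (I : Type) (le : I -> I -> Prop)
    (u : I -> \bar R) : \bar R :=
  ereal_sup [set ereal_inf [set u j | j in [set j | le i j]] | i in [set: I]].

Definition right_entourage (G : topologicalGroupType) : set_system (G * G) :=
  filter_from (nbhs (1%g : G)) (fun U => [set p | U (p.2 * p.1^-1)%g]).

Definition RUCB (R : realType) (G : topologicalGroupType) : set (G -> R) :=
  [set f | (exists M : R, forall x, `|f x| <= M) /\
    forall e : R, 0 < e -> right_entourage [set p | `|f p.1 - f p.2| < e]].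

Definition RUEB (R : realType) (G : topologicalGroupType) : set (set (G -> R)) :=
  [set H | [/\ H `<=` @RUCB R G,
    exists M : R, forall f, H f -> forall x, `|f x| <= M &
    forall e : R, 0 < e ->
      right_entourage [set p | forall f, H f -> `|f p.1 - f p.2| < e]]].

(* The set under [sup] is bounded since H is bounded in supremum norm. For     *)
(* empty H the real-valued [sup] is 0 (ereal_sup would be -oo).                *)
Definition UEB_converges_to_invariance (R : realType) (G : topologicalGroupType)
    (I : Type) (le : I -> I -> Prop) (mu : I -> probability (borelType G) R) :
    Prop :=
  forall (g : G) (H : set (G -> R)), @RUEB R G H ->
    (fun i => sup [set `| (\int[mu i]_x f (g * (x : G))%g)
                         - (\int[mu i]_x f x) | | f in H])
      @ tails le --> (0 : R).

(* The maximum with 0 makes the diameter of the empty set 0 instead of -oo.    *)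
Definition diam (R : realType) (B : set R) : \bar R :=
  maxe 0%E (ereal_sup [set `|p.1 - p.2|%:E | p in B `*` B]).

(* [nu] is a bare set function so that it can be instantiated with             *)
(* [pushforward mu f], a probability measure whenever f is measurable.         *)
Definition PartDiam (R : realType) (nu : set (measurableTypeR R) -> \bar R)
    (s : R) : \bar R :=
  ereal_inf [set diam B | B in
    [set B : set (measurableTypeR R) | measurable B /\ (s%:E <= nu B)%E]].

(* This is ObsDiam(Y, rho, mu; - alpha). *)
Definition ObsDiam (R : realType) (Y : ptopologicalType) (rho : Y -> Y -> R)
    (mu : probability (borelType Y) R) (alpha : R) : \bar R :=
  ereal_sup [set PartDiam
      (pushforward mu (f : borelType Y -> measurableTypeR R)) (1 - alpha) |
    f in [set f : Y -> R | forall x y, `|f x - f y| <= rho x y]].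

(* Main.v *)
Require Import Defs.
From HB Require Import structures.
From mathcomp Require Import all_boot all_order all_algebra.
From mathcomp Require Import all_classical all_reals all_analysis.
From mathcomp Require Import measurable_realfun ring lra.

Set Implicit Arguments.
Unset Strict Implicit.
Unset Printing Implicit Defensive.

Import Order.TTheory GRing.Theory Num.Theory.
Import numFieldNormedType.Exports.

Local Open Scope classical_set_scope.
Local Open Scope ring_scope.

(* By compactness of X it is enough to find, for a finite set E in G and a     *)
(* bound a strictly above the right-hand side, a point moved by each g in E by *)
(* at most a + 3r. Fix x, and cover X by finitely many d-balls of radius r,    *)
(* with centres c. Choose alpha small, then i such that mu_i concentrates at   *)
(* level a and is almost invariant on the functions below. If the orbit map    *)
(* h |-> hx sends mu_i-mass more than alpha into the ball at c, concentration  *)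
(* of h |-> d(hx, c) gives d(hx, c) <= a + r up to mass alpha, and invariance  *)
(* of the integral of a truncation of d(hx, c) - (a + r) transfers this to     *)
(* d(ghx, c) < a + 2r up to mass 2 alpha. As the number of pairs (g, c) was    *)
(* fixed before alpha, a union bound yields h avoiding all exceptional sets;   *)
(* then hx lies in some ball, and d(hx, ghx) <= r + (a + 2r).                  *)

(** Both hypotheses are used only through the scalar functions h |-> d(hx, c). They are 1-Lipschitz
    for the pseudo-metric that [d] induces along the orbit of x, so a small observable diameter
    concentrates them ([PartDiam_concentration]). Truncated, they belong to RUCB(G), because
    elements of G near 1 move all points of X uniformly little ([act_near1], [RUCB_orbit]), so their
    integrals are almost invariant. [markov_truncated] and [Rintegral_truncated_le] turn integrals
    back into masses, and [almost_fixed_point] assembles the union bound. The theorem then takes a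
    cluster point of the closed sets of almost fixed points. *)

Lemma open_borel (Y : ptopologicalType) (A : set Y) :
  open A -> measurable (A : set (borelType Y)).
Proof. exact: sub_sigma_algebra. Qed.

Lemma continuous_borel_measurable (R : realType) (Y : ptopologicalType)
    (f : Y -> R) :
  continuous f -> measurable_fun [set: borelType Y] (f : borelType Y -> R).
Proof.
move=> /continuousP cf; apply: (measurability (@RGenOpens.G R)).
  exact: RGenOpens.measurableE.
move=> _ [_ [a [b ->]] <-]; rewrite setTI.
by apply: open_borel; apply: cf; exact: interval_open.
Qed.

Lemma measurable_preimage_itv d (T : measurableType d) (R : realType)
    (f : T -> R) (I : interval R) :
  measurable_fun setT f -> measurable (f @^-1` [set` I]).
Proof. by move=> mf; rewrite -[_ @^-1` _]setTI; exact: mf. Qed.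

Lemma union_bound d (T : measurableType d) (R : realType) (P : probability T R)
    (J : eqType) (s : seq J) (A : J -> set T) (b : R) :
  (forall j, measurable (A j)) -> (forall j, j \in s -> (P (A j) <= b%:E)%E) ->
  (size s)%:R * b < 1 -> exists x, forall j, j \in s -> ~ A j x.
Proof.
move=> mA PA sb; apply: contrapT => nox.
pose B (t : seq J) := [set x | exists2 j, j \in t & A j x].
(* The induction runs over sublists of [s], so that the bound on each [A j] stays available. For [s]
   itself the union would be the whole space, of mass 1. *)
have BP t : {subset t <= s} ->
    measurable (B t) /\ (P (B t) <= ((size t)%:R * b)%:E)%E.
  elim: t => [|j t IH] ts.
    have -> : B [::] = set0 by rewrite -subset0 => x [].
    by rewrite measure0 mul0r; split => //; exact: measurable0.
  have [|mB PB] := IH; first by move=> k kt; rewrite ts// inE kt orbT.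
  have -> : B (j :: t) = A j `|` B t.
    apply/seteqP; split=> x.
      move=> [k]; rewrite inE => /orP[/eqP->|kt] Ak; [by left|].
      by right; exists k.
    move=> [Ax|[k kt Ak]]; first by exists j; rewrite ?mem_head.
    by exists k; rewrite // inE kt orbT.
  split; first exact: measurableU.
  rewrite (le_trans (measureU2 _ _ _))// /= -natr1 mulrDl mul1r addrC EFinD.
  by apply: leeD => //; apply: PA; apply: ts; rewrite mem_head.
have BT : B s = setT.
  rewrite -subTset => x _; apply: contrapT => nB; apply: nox.
  by exists x => j js Aj; apply: nB; exists j.
have := (BP s (fun _ => id)).2; rewrite BT probability_setT lee_fin.
by rewrite leNgt sb.
Qed.

(** * Integrals versus masses, and concentration *)

Section truncated_integral.
Context d (T : measurableType d) (R : realType) (P : probability T R).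
Variables (f : T -> R) (r : R).
Hypotheses (mf : measurable_fun setT f) (r0 : 0 < r).
Hypothesis f0r : forall x, 0 <= f x <= r.

Lemma Rintegral_truncatedE :
  (\int[P]_x f x)%:E = (\int[P]_x (f x)%:E)%E.
Proof.
rewrite /Rintegral fineK//; apply: integrable_fin_num => //.
apply: measurable_bounded_integrable => //.
  exact: (le_lt_trans (probability_le1 P measurableT) (ltry 1)).
exists r; split; first exact: num_real.
move=> M rM x _ /=; have /andP[f0 fr] := f0r x.
by rewrite ger0_norm// (le_trans fr)// ltW.
Qed.

(** Markov's inequality. With [Rintegral_truncated_le] it encloses the integral between [r] times
    the masses of [r <= f] and of [0 < f], so almost equal integrals of two such functions compare
    these masses. *)
Lemma markov_truncated :
  (r%:E * P [set x | (r <= f x)%R] <= (\int[P]_x f x)%:E)%E.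
Proof.
rewrite Rintegral_truncatedE.
have := @le_integral_abse _ _ _ P setT measurableT (EFin \o f) r.
rewrite setTI => /(_ _ r0) H; apply: le_trans (le_trans (H _) _).
- rewrite le_eqVlt; apply/orP; left; apply/eqP; congr (_ * P _)%E.
  apply/seteqP; split=> x /=; rewrite lee_fin ger0_norm//;
  by have /andP[] := f0r x.
- exact/measurable_EFinP.
- rewrite le_eqVlt; apply/orP; left; apply/eqP; apply: eq_integral => x _ /=.
  by rewrite ger0_norm//; have /andP[] := f0r x.
Qed.

(** [f] is at most [r] times the indicator of the set where it is positive. *)
Lemma Rintegral_truncated_le :
  ((\int[P]_x f x)%:E <= r%:E * P [set x | (0 < f x)%R])%E.
Proof.
have mA : measurable [set x | 0 < f x].
  by have := measurable_preimage_itv `]0, +oo[ mf; rewrite set_itvE.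
rewrite Rintegral_truncatedE -integral_cst// integral_mkcond.
apply: ge0_le_integral => //.
- by move=> x _; rewrite lee_fin; have /andP[] := f0r x.
- exact/measurable_EFinP.
- apply/(measurable_restrictT _ mA); exact: measurable_cst.
move=> x _; rewrite patchE; have /andP[f0 fr] := f0r x.
case: ifPn => [_|]; first by rewrite lee_fin.
by rewrite notin_setE /= => /negP; rewrite -leNgt lee_fin.
Qed.

End truncated_integral.

(** Some [B] of diameter below [a] has a preimage whose complement has mass at most [alpha]. The set
    [f < r] is too heavy to lie in that complement, so [B] contains a value below [r], and all its
    values are then below [a + r]. *)
Lemma PartDiam_concentration (R : realType) d (T : measurableType d)
    (P : probability T R) (f : T -> measurableTypeR R) (a r alpha : R) :
  measurable_fun setT f ->
  (PartDiam (pushforward P f) (1 - alpha) < a%:E)%E ->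
  (alpha%:E < P [set x | (f x < r)%R])%E ->
  (P [set x | (a + r < f x)%R] <= alpha%:E)%E.
Proof.
move=> mf /ereal_inf_lt[_ [B [mB PB] <-] Ba] Pr.
have mfB : measurable (f @^-1` B) by rewrite -[_ @^-1` _]setTI; exact: mf.
have PC : (P (~` (f @^-1` B)) <= alpha%:E)%E.
  rewrite probability_setC// leeBlDr; last exact: fin_num_measure.
  by rewrite -leeBlDl// -EFinB.
have [x0 [Bx0 x0r]] : exists x0, B (f x0) /\ f x0 < r.
  apply: contrapT => nB; move: Pr; rewrite ltNge => /negP; apply.
  apply: le_trans PC; apply: le_measure; rewrite ?inE.
  - by have := measurable_preimage_itv `]-oo, r[%R mf; rewrite set_itvE.
  - exact: measurableC.
  - by move=> x xr Bx; apply: nB; exists x.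
apply: le_trans PC; apply: le_measure; rewrite ?inE.
- by have := measurable_preimage_itv `]a + r, +oo[%R mf; rewrite set_itvE.
- exact: measurableC.
- move=> x /= arx Bx.
  have : (`|f x - f x0|%:E <= diam B)%E.
    rewrite /diam le_max; apply/orP; right.
    by apply: ereal_sup_ubound; exists (f x, f x0).
  move=> /le_lt_trans/(_ Ba); rewrite lte_fin => H.
  by have := ler_norm (f x - f x0); lra.
Qed.

(** * Total boundedness and truncated distances *)

Section pseudometric.
Context (R : realType) (X : topologicalType) (d : X -> X -> R).
Hypothesis dP : is_continuous_pseudometric d.

Let d_ge0 x y : 0 <= d x y. Proof. exact: pseudometric_ge0 dP.1 _ _. Qed.
Let d_refl x : d x x = 0. Proof. exact: pseudometric_refl dP.1 _. Qed.
Let d_sym x y : d x y = d y x. Proof. exact: pseudometric_sym dP.1 _ _. Qed.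
Let d_triangle x y z : d x z <= d x y + d y z.
Proof. exact: pseudometric_triangle dP.1 _ _ _. Qed.

Lemma continuous_pseudometric_comp (Y : topologicalType) (f g : Y -> X) :
  continuous f -> continuous g -> continuous (fun y => d (f y) (g y)).
Proof.
move=> cf cg y.
apply: (@continuous_comp _ _ _ (fun y => (f y, g y)) (fun p => d p.1 p.2)).
  by apply: cvg_pair; [exact: cf|exact: cg].
exact: dP.2.
Qed.

Lemma dist_lipschitz (c x y : X) : `|d x c - d y c| <= d x y.
Proof.
rewrite ler_norml; have := d_triangle x y c; have := d_triangle y x c.
by rewrite (d_sym y x); lra.
Qed.

Lemma compact_totally_bounded (r : R) : compact [set: X] -> 0 < r ->
  exists s : seq X, forall x, exists2 c, c \in s & d x c < r.
Proof.
move=> /compact_near_coveringP cX r0.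
(* Finite lists directed by inclusion: near each [x], every list containing [x] serves. The
   near-covering form of compactness makes one list serve all points. *)
pose F : set_system (seq X) :=
  filter_from setT (fun t : seq X => [set s : seq X | {subset t <= s}]).
have FF : Filter F.
  apply: filter_from_filter; first by exists [::].
  move=> s t _ _; exists (s ++ t) => // u stu.
  by split=> z zs; apply: stu; rewrite mem_cat zs ?orbT.
have [] := cX _ F (fun s x => exists2 c, c \in s & d x c < r) FF.
  move=> x _.
  exists ([set y | d y x < r], [set s : seq X | x \in s]); last first.
    by move=> [y s] [/= yr xs]; exists x.
  split=> /=; last by exists [:: x] => // s; apply; rewrite mem_head.
  have /(_ x) : continuous (fun y => d y x).
    apply: continuous_pseudometric_comp; first by move=> ?; exact: cvg_id.
    by move=> ?; exact: cvg_cst.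
  move=> /cvgrPdist_lt/(_ r r0); rewrite d_refl.
  by apply: filterS => y; rewrite sub0r normrN ger0_norm.
by move=> s _ sX; exists s => x; apply: (sX s) => //; exact.
Qed.

(** A ramp in the distance to [c]: 0 up to [a], slope 1 in between, constant [r] from [a + r] on. It
    is a Lipschitz substitute for an indicator function. *)
Definition trunc_dist (r a : R) (c x : X) : R :=
  Num.min r (Num.max 0 (d x c - a)).

Lemma trunc_dist_bounds (r a : R) (c x : X) :
  0 < r -> 0 <= trunc_dist r a c x <= r.
Proof.
by move=> r0; rewrite /trunc_dist le_min ge_min lexx le_max lexx (ltW r0).
Qed.

Lemma trunc_dist_gt0 (r a : R) (c x : X) :
  0 < trunc_dist r a c x -> a < d x c.
Proof. by rewrite lt_min lt_max ltxx /= subr_gt0 => /andP[]. Qed.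

Lemma trunc_dist_ge (r a : R) (c x : X) :
  a + r <= d x c -> r <= trunc_dist r a c x.
Proof. by move=> ar; rewrite le_min lexx /= le_max; apply/orP; right; lra. Qed.

Lemma trunc_dist_lipschitz (r a : R) (c x y : X) :
  `|trunc_dist r a c x - trunc_dist r a c y| <= d x y.
Proof.
apply: le_trans (dist_lipschitz c x y); rewrite /trunc_dist.
case: (leP 0 (d x c - a)) => ?; case: (leP 0 (d y c - a)) => ?;
  repeat match goal with |- context [Num.min r ?t] => case: (leP r t) => ? end;
  rewrite ler_norml; case: (ger0P (d x c - d y c)) => ?; apply/andP; split; lra.
Qed.

End pseudometric.

(** * Invariance along the net *)

Lemma tails_filter (I : Type) (le : I -> I -> Prop) :
  is_directed le -> Filter (tails le).
Proof.
move=> [[i0] _ le_trans le_ub]; apply: filter_from_filter; first by exists i0.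
move=> i j _ _; have [k [ik jk]] := le_ub i j.
by exists k => // l kl; split; apply: le_trans kl.
Qed.

(** UEB-convergence is applied to the singleton of [f], over which the supremum is a single
    value. *)
Lemma UEB_invariance_RUCB (R : realType) (G : topologicalGroupType)
    (I : Type) (le : I -> I -> Prop) (mu : I -> probability (borelType G) R)
    (g : G) (f : G -> R) (e : R) :
  is_directed le -> UEB_converges_to_invariance le mu -> RUCB f -> 0 < e ->
  tails le [set i | `|(\int[mu i]_x f (g * (x : G))%g)
                      - (\int[mu i]_x f x)| < e].
Proof.
move=> /tails_filter FF mu_inv [[M fM] fu] e0.
have Hf : RUEB [set f].
  split; first by move=> _ ->; split => //; exists M.
    by exists M => _ ->.
  move=> e' /fu; rewrite /right_entourage.
  by move=> [U U1 Uf]; exists U => // p Up _ ->; exact: Uf.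
have /cvgrPdist_lt/(_ e e0) := mu_inv g _ Hf.
move=> [i0 _ Hi]; exists i0 => // i /Hi /=.
by rewrite image_set1 sup1 sub0r normrN normr_id.
Qed.

(** * Orbit maps and almost fixed points *)

Section flow.
Context (R : realType) (G : topologicalGroupType) (X : topologicalType).
Variables (act : G -> X -> X) (d : X -> X -> R).
Hypotheses (act_flow : is_flow act) (dP : is_continuous_pseudometric d).

Lemma continuous_orbit (x : X) : continuous (fun g => act g x).
Proof.
move=> g; apply: (@continuous_comp _ _ _ (fun g => (g, x))
  (fun p => act p.1 p.2)); last exact: (flow_continuous act_flow).
by apply: cvg_pair; [exact: cvg_id|exact: cvg_cst].
Qed.

Lemma continuous_act (g : G) : continuous (act g).
Proof.
move=> x; apply: (@continuous_comp _ _ _ (fun x => (g, x))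
  (fun p => act p.1 p.2)); last exact: (flow_continuous act_flow).
by apply: cvg_pair; [exact: cvg_cst|exact: cvg_id].
Qed.

(** A tube argument: 1 moves no point and the action is jointly continuous, so compactness gives one
    neighborhood of 1 valid for all points. *)
Lemma act_near1 (e : R) : 0 < e ->
  \forall k \near (1%g : G), forall y, d y (act k y) < e.
Proof.
move=> e0; have /compact_near_coveringP cX := flow_compact act_flow.
have H : \forall k \near (1%g : G), [set: X] `<=` (fun y => d y (act k y) < e).
  apply: (cX G (nbhs (1%g : G)) (fun k y => d y (act k y) < e)) => x _.
  have : continuous (fun p : X * G => d p.1 (act p.2 p.1)).
    apply: (continuous_pseudometric_comp dP); first by move=> ?; exact: cvg_fst.
    move=> p; apply: (@continuous_comp _ _ _ (fun p : X * G => (p.2, p.1))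
      (fun p => act p.1 p.2)); last exact: (flow_continuous act_flow).
    by apply: cvg_pair; [exact: cvg_snd|exact: cvg_fst].
  move=> /(_ (x, 1%g)) /cvgrPdist_lt/(_ e e0) /=.
  rewrite (flow_act1 act_flow) (pseudometric_refl dP.1).
  apply: filterS => p; rewrite sub0r normrN; apply: le_lt_trans.
  exact: ler_norm.
by apply: filterS H => k Hk y; exact: Hk.
Qed.

(** The element k h^-1, which the right uniformity makes close to 1, carries hx to kx. *)
Lemma RUCB_orbit (F : X -> R) (M : R) (x : X) :
  (forall y, `|F y| <= M) -> (forall y z, `|F y - F z| <= d y z) ->
  RUCB (fun g : G => F (act g x)).
Proof.
move=> FM Fd; split; first by exists M.
move=> e /act_near1 e0; exists [set k : G | forall y, d y (act k y) < e] => //.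
move=> [h k] /= /(_ (act h x)); rewrite -(flow_actM act_flow) mulgVK.
exact: le_lt_trans.
Qed.

Lemma almost_fixed_point (I : Type) (le : I -> I -> Prop)
    (mu : I -> probability (borelType G) R) (a r : R) (E : seq G) :
  is_directed le -> UEB_converges_to_invariance le mu -> 0 < r ->
  (forall alpha, 0 < alpha -> (net_liminf le (fun i =>
      ereal_sup [set ObsDiam (fun g h : G => d (act g x) (act h x)) (mu i) alpha
                | x in [set: X]]) < a%:E)%E) ->
  exists x, forall g, g \in E -> d x (act g x) <= a + 3 * r.
Proof.
move=> le_dir mu_inv r0 Ha; have FF := tails_filter le_dir.
have [x _] := flow_nonempty act_flow.
have [s sX] := compact_totally_bounded dP (flow_compact act_flow) r0.
pose J := [seq (g, c) | g <- E, c <- s].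
(* Exceptional sets of mass at most [2 * alpha], one per entry of [J], then have total mass below 1,
   even for empty [J]. *)
pose alpha : R := (2 * ((size J)%:R + 1))^-1.
have J0 : 0 <= (size J)%:R :> R by exact: ler0n.
have alpha0 : 0 < alpha by rewrite invr_gt0; lra.
pose psi (c : X) (h : G) := trunc_dist d r (a + r) c (act h x).
have psi_bounds c h : 0 <= psi c h <= r by exact: trunc_dist_bounds.
have near_inv (K : seq (G * X)) (e : R) : 0 < e ->
    \forall i \near tails le, forall j, j \in K ->
    `|(\int[mu i]_h psi j.2 (j.1 * (h : G))%g) - (\int[mu i]_h psi j.2 h)| < e.
  move=> e0; elim: K => [|j t IH]; first exact: filterE.
  have Hj : RUCB (psi j.2).
    apply: (@RUCB_orbit _ r) => y;
      last by move=> z; exact: trunc_dist_lipschitz.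
    have /andP[? ?] := trunc_dist_bounds d (a + r) j.2 y r0.
    by rewrite ger0_norm.
  have := UEB_invariance_RUCB j.1 le_dir mu_inv Hj e0.
  apply: filterS2 IH => i Hi Hj' k.
  by rewrite inE => /orP[/eqP->|/Hi].
(* After division by [r] in Markov's inequality, an error [r * alpha] costs mass [alpha]. *)
have [i0 _ Hi0] := near_inv J _ (mulr_gt0 r0 alpha0).
(* The liminf gives concentration only at some index of each tail. Almost invariance holds on the
   whole tail of [i0], so one [i] has both. *)
have /ereal_inf_lt[_ [i i0i <-] Hi] : (ereal_inf [set ereal_sup [set ObsDiam
    (fun g h : G => d (act g x) (act h x)) (mu i) alpha | x in [set: X]]
    | i in [set j | le i0 j]] < a%:E)%E.
  by apply: le_lt_trans (Ha _ alpha0); apply: ereal_sup_ubound; exists i0.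
have {}Hi0 := Hi0 _ i0i.
pose f (c : X) (h : G) := d (act h x) c.
have cf c : continuous (f c).
  by apply: (continuous_pseudometric_comp dP);
    [exact: continuous_orbit|move=> ?; exact: cvg_cst].
have mf c := continuous_borel_measurable (cf c).
have mulg_cont (g : G) : continuous (fun h : G => (g * h)%g).
  move=> h; apply: (@continuous_comp _ _ _ (fun h => (g, h))
    (fun p : G * G => (p.1 * p.2)%g)); last exact: mulg_continuous.
  by apply: cvg_pair; [exact: cvg_cst|exact: cvg_id].
have cpsi c : continuous (psi c).
  move=> h; rewrite /psi /trunc_dist.
  apply: (@continuous_min R G (fun=> r)
    (fun h => Num.max 0 (f c h - (a + r))) h); first exact: cvg_cst.
  apply: (@continuous_max R G (fun=> 0) (fun h => f c h - (a + r)) h).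
    exact: cvg_cst.
  by apply: cvgB; [exact: cf|exact: cvg_cst].
have mpsi c := continuous_borel_measurable (cpsi c).
have cpsig g c : continuous (fun h : G => psi c (g * h)%g).
  by move=> h; apply: continuous_comp; [exact: mulg_cont|exact: cpsi].
have mpsig g c := continuous_borel_measurable (cpsig g c).
have conc c : (alpha%:E < mu i [set h | (f c h < r)%R])%E ->
    (mu i [set h | (a + r < f c h)%R] <= alpha%:E)%E.
  apply: (PartDiam_concentration (mf c)).
  apply: le_lt_trans Hi; apply: le_trans (ereal_sup_ubound _); last first.
    by exists x.
  apply: ereal_sup_ubound; exists (f c) => // h k.
  exact: dist_lipschitz.
have shift g c : (g, c) \in J -> (alpha%:E < mu i [set h | (f c h < r)%R])%E ->
    (mu i [set h | (r <= psi c (g * h)%g)%R] <= (2 * alpha)%:E)%E.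
  move=> gcJ /conc Hc.
  have Hp : (mu i [set h | (0 < psi c h)%R] <= alpha%:E)%E.
    apply: le_trans Hc; apply: le_measure; rewrite ?inE.
    - by have := measurable_preimage_itv `]0, +oo[%R (mpsi c); rewrite set_itvE.
    - have := measurable_preimage_itv `]a + r, +oo[%R (mf c).
      by rewrite set_itvE.
    - by move=> h /trunc_dist_gt0.
  rewrite -(@lee_pmul2l _ r%:E)//.
  apply: le_trans (markov_truncated (mu i) (mpsig g c) r0
    (fun h => psi_bounds c (g * h)%g)) _.
  have := Rintegral_truncated_le (mu i) (mpsi c) (psi_bounds c).
  have rE : (0 <= r%:E)%E by rewrite lee_fin ltW.
  move=> /le_trans/(_ (lee_wpmul2l rE Hp)).
  rewrite -!EFinM !lee_fin; have /= := Hi0 _ gcJ.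
  by rewrite ltr_norml => /andP[_]; lra.
(* If the ball at c is heavy, the exceptional h send ghx far from c; if it is light, they send hx
   into the ball. Hence, when hx lies in the ball at c and h is not exceptional, the heavy case
   holds and ghx is close to c. *)
pose A (j : G * X) : set (borelType G) :=
  if `[< (alpha%:E < mu i [set h | (f j.2 h < r)%R])%E >]
  then [set h | r <= psi j.2 (j.1 * (h : G))%g] else [set h | f j.2 h < r].
have [||| h hJ] := @union_bound _ _ _ (mu i) _ J A (2 * alpha).
- move=> [g c]; rewrite /A /=; case: asboolP => _.
    have := measurable_preimage_itv `[r, +oo[%R (mpsig g c).
    by rewrite set_itvE.
  by have := measurable_preimage_itv `]-oo, r[%R (mf c); rewrite set_itvE.
- move=> [g c] gcJ; rewrite /A /=; case: asboolP => [/(shift _ _ gcJ)//|].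
  move=> /negP; rewrite -leNgt => /le_trans; apply; rewrite lee_fin; lra.
- have -> : 2 * alpha = ((size J)%:R + 1)^-1.
    by rewrite /alpha; field; rewrite !gt_eqF//; lra.
  by rewrite ltr_pdivrMr; lra.
exists (act h x) => g gE.
have [c cs hc] := sX (act h x).
have gcJ : (g, c) \in J by apply/allpairsP; exists (g, c).
have := hJ _ gcJ; rewrite /A /=; case: asboolP => [_|//] /negP.
rewrite -ltNge => psir.
have : d (act (g * h)%g x) c < a + r + r.
  by rewrite ltNge; apply/negP => /trunc_dist_ge; rewrite leNgt => /negP.
rewrite (flow_actM act_flow) => gc.
have := pseudometric_triangle dP.1 (act h x) c (act g (act h x)).
by rewrite (pseudometric_sym dP.1 c); lra.
Qed.

End flow.

(** * From almost fixed points to the bound for all of G *)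

Lemma lte_dense_fin (R : realType) (x : \bar R) (y : R) :
  (x < y%:E)%E -> exists2 z : R, (x < z%:E)%E & z < y.
Proof.
case: x => [x| |] //=; last by exists (y - 1); rewrite ?ltNyr//; lra.
by rewrite lte_fin => xy; exists ((x + y) / 2); rewrite ?lte_fin; lra.
Qed.

Theorem corollary1p3 (R : realType) (G : topologicalGroupType)
    (G_hausdorff : hausdorff_space G)
    (I : Type) (le : I -> I -> Prop) (le_directed : is_directed le)
    (mu : I -> probability (borelType G) R)
    (mu_invariance : UEB_converges_to_invariance le mu)
    (X : topologicalType) (act : G -> X -> X) (act_flow : is_flow act)
    (d : X -> X -> R) (d_pseudometric : is_continuous_pseudometric d) :
  exists x0 : X,
    (ereal_sup [set (d x0 (act g x0))%:E | g in [set: G]] <=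
     ereal_sup [set net_liminf le (fun i =>
         ereal_sup [set ObsDiam (fun g h : G => d (act g x) (act h x))
                                (mu i) alpha | x in [set: X]])
       | alpha in [set alpha : R | (0 < alpha)%R]])%E.
Proof.
set D := ereal_sup (image _ _).
have [x1 _] := flow_nonempty act_flow.
have [Doo|/eqP Doo] := pselect (D = +oo%E).
  by exists x1; rewrite Doo leey.
have [c1 Dc1] : exists c : R, (D < c%:E)%E.
  case: (D) Doo => [b| |] // _; last by exists 0; exact: ltNyr.
  by exists (b + 1); rewrite lte_fin; lra.
pose fixed (cE : R * seq G) :=
  [set x | forall g, g \in cE.2 -> d x (act g x) <= cE.1].
(* Taking the smaller bound and concatenating the lists makes these sets a filter base.
   [almost_fixed_point] shows that none is empty. *)
pose F := filter_from [set cE : R * seq G | (D < cE.1%:E)%E] fixed.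
have FF : ProperFilter F.
  apply: filter_from_proper.
    apply: filter_from_filter; first by exists (c1, [::]).
    move=> [c E] [c' E'] /= Dc Dc'; exists (Num.min c c', E ++ E').
      by rewrite /= /Num.min /Order.min; case: ifP.
    move=> x /= Hx; split=> g gE; have := Hx g; rewrite mem_cat gE ?orbT le_min.
      by move=> /(_ isT)/andP[].
    by move=> /(_ isT)/andP[].
  move=> [c E] /= /lte_dense_fin[a Da ac].
  (* With this radius, [a + 3 * r] is exactly [c]. *)
  have r0 : 0 < (c - a) / 3 by lra.
  have [|x Hx] := almost_fixed_point act_flow d_pseudometric (a := a) E
    le_directed mu_invariance r0.
    move=> alpha alpha0; apply: le_lt_trans Da.
    by apply: ereal_sup_ubound; exists alpha.
  by exists x => g /Hx /=; lra.
have [x0 [_ x0F]] := flow_compact act_flow FF filterT.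
exists x0; apply: ge_ereal_sup => _ [g _ <-]; rewrite leNgt; apply/negP.
move=> /lte_dense_fin[c Dc]; rewrite ltNge => /negP; apply.
have cdg : continuous (fun x => d x (act g x)).
  apply: (continuous_pseudometric_comp d_pseudometric).
    by move=> ?; exact: cvg_id.
  exact: (continuous_act act_flow).
have cl : closed [set x | d x (act g x) <= c].
  exact: (closed_comp (fun x _ => cdg x) (@closed_le R c)).
(* A cluster point of [F] lies in every closed member of [F]; the relevant one comes from the
   one-element list of [g]. *)
apply: cl => B Bx0; have Fg : F [set x | d x (act g x) <= c].
  by exists (c, [:: g]) => // x; apply; rewrite mem_head.
exact: x0F.
Qed.
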